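(* Fix $\alpha>0$. As $\Gamma\to\infty$, each of the following three upper bounds on $F_\alpha(\Gamma)$ has the form $\alpha\log(\Gamma)+c_{\alpha}+o(1)$: (i) the channel coding converse bound $\min\{2E_0(\alpha,\Gamma),\gamma_\alpha\Gamma\}$, with $c_\alpha=\alpha-(1+\alpha)\log(1+\alpha)$; (ii) the spherical cap bound (equal to $\gamma_\alpha\Gamma$ for $\Gamma<\alpha/\gamma_\alpha$ and to $\alpha[\log(\gamma_\alpha\Gamma/\alpha)+1]$ for $\Gamma\ge\alpha/\gamma_\alpha$), with $c_\alpha=\alpha\log(\gamma_\alpha/\alpha)+\alpha$; (iii) for $\alpha\ge2$, the spectrum replication bound $\gamma_{\alpha}\Gamma-[\alpha\Lambda_{\alpha}(\Gamma)]_{+}$, with $c_\alpha=\alpha\log(e/8)$. Moreover, for $\alpha<2$, when $\gamma_\alpha$ in the spectrum replication bound is replaced by the upper bound $\bar\gamma_\alpha$ below, the resulting bound increases linearly with $\Gamma$ as $\Gamma\to\infty$.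
   Context: $\Gamma>0$ is the SNR, $F_\alpha(\Gamma)$ is the optimal MP$\alpha$E exponent per unit bandwidth for conveying a parameter $u\in[0,1)$ over a band-limited AWGN channel (largest achievable exponent of $\sup_u\mathbb{E}_u|\hat u-u|^\alpha$ divided by the bandwidth $W$, with $\Gamma=P/(N_0W)$), and $\gamma_\alpha=\lim_{\Gamma\to0}F_\alpha(\Gamma)/\Gamma$ is the unlimited-bandwidth MP$\alpha$E exponent; for $\alpha\ge2$ one has $\gamma_\alpha=\frac{\alpha}{2(1+\alpha)}$. Definitions: $E_{0}(\rho,\Gamma)=\frac{1}{2}\left[(1-\beta_{0})(1+\rho)+\Gamma+\log\left(\beta_{0}-\frac{\Gamma}{1+\rho}\right)+\rho\log(\beta_{0})\right]$ with $\beta_{0}=\frac{1}{2}\left(1+\frac{\Gamma}{1+\rho}\right)\left[1+\sqrt{1-\frac{4\Gamma\rho}{(1+\rho+\Gamma)^{2}}}\right]$; $[t]_+=\max\{t,0\}$, $\Lambda_{\alpha}(\Gamma)=\sup_{0<\rho\leq1}\frac{\Phi(\rho,\Gamma)-\gamma_{\alpha}\Gamma}{\rho}$, $\Phi(\rho,\Gamma)=\rho[\eta-1-\log\eta]+\eta+\Gamma+\log\left[\frac{\sqrt{4\eta\Gamma+1}+1}{2\eta}\right]-\sqrt{4\eta\Gamma+1}$ with $\eta=\frac{\Gamma+\sqrt{\Gamma^{2}-4(\rho^{2}+1)(\rho+1)^{2}}}{2(\rho+1)^{2}}$. The upper bound $\bar\gamma_\alpha\ge\gamma_\alpha$ is: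 $\bar\gamma_\alpha=\frac{1}{1+\alpha}\min\{\alpha,\psi(\alpha)\}$ for $0<\alpha\le\alpha_0$; $\bar\gamma_\alpha=\frac{\alpha}{2(1+\alpha)}\left[1+\frac{\alpha+5-4\sqrt{\alpha+1}}{3\alpha+1}\right]$ for $\alpha_0\le\alpha\le2$; $\bar\gamma_\alpha=\frac{\alpha}{2(1+\alpha)}$ for $\alpha\ge2$, where $\alpha_0\approx1.5875$ is the unique root of $\alpha^2-(\alpha-1)\sqrt{\alpha+1}-2=0$ and $\psi(\alpha)=1+\alpha-\max_{q\ge1/2}[2\alpha q+4q\sqrt{(1-q)q(1+\alpha)}-q^2(3\alpha+1)]$. Logarithms are natural. *)

(* Defs.v *)
From HB Require Import structures.
From mathcomp Require Import all_boot all_order all_algebra.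
From mathcomp Require Import all_classical all_reals all_analysis.
Set Implicit Arguments. Unset Strict Implicit. Unset Printing Implicit Defensive.
Import Order.TTheory GRing.Theory Num.Theory.
Import numFieldNormedType.Exports.
Local Open Scope classical_set_scope.
Local Open Scope ring_scope.

Section Defs.
Variable R : realType.
Implicit Types (rho G alpha gam q : R).

Definition beta0 rho G : R :=
  2^-1 * (1 + G / (1 + rho)) *
  (1 + Num.sqrt (1 - 4 * G * rho / (1 + rho + G) ^+ 2)).

Definition E0 rho G : R :=
  2^-1 * ((1 - beta0 rho G) * (1 + rho) + G
          + ln (beta0 rho G - G / (1 + rho)) + rho * ln (beta0 rho G)).

Definition cc_bound alpha gam G : R := Num.min (2 * E0 alpha G) (gam * G).

Definition sc_bound alpha gam G : R :=
  if G < alpha / gam then gam * G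
  else alpha * (ln (gam * G / alpha) + 1).

Definition eta rho G : R :=
  (G + Num.sqrt (G ^+ 2 - 4 * (rho ^+ 2 + 1) * (rho + 1) ^+ 2))
  / (2 * (rho + 1) ^+ 2).

Definition Phi rho G : R :=
  rho * (eta rho G - 1 - ln (eta rho G)) + eta rho G + G
  + ln ((Num.sqrt (4 * eta rho G * G + 1) + 1) / (2 * eta rho G))
  - Num.sqrt (4 * eta rho G * G + 1).

Definition Lambda gam G : R :=
  sup [set (Phi rho G - gam * G) / rho | rho in `]0, 1]].

Definition sr_bound alpha gam G : R :=
  gam * G - Num.max (alpha * Lambda gam G) 0.

Definition psi alpha : R :=
  1 + alpha -
  sup [set 2 * alpha * q + 4 * q * Num.sqrt ((1 - q) * q * (1 + alpha))
           - q ^+ 2 * (3 * alpha + 1) | q in `[2^-1, 1]].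

Definition alpha0_eq a0 : R := a0 ^+ 2 - (a0 - 1) * Num.sqrt (a0 + 1) - 2.

Definition gamma_bar a0 alpha : R :=
  if alpha <= a0 then (1 + alpha)^-1 * Num.min alpha (psi alpha)
  else if alpha <= 2 then
    alpha / (2 * (1 + alpha)) *
    (1 + (alpha + 5 - 4 * Num.sqrt (alpha + 1)) / (3 * alpha + 1))
  else alpha / (2 * (1 + alpha)).

End Defs.

(* Main.v *)
Require Import Defs.
From HB Require Import structures.
From mathcomp Require Import all_boot all_order all_algebra.
From mathcomp Require Import all_classical all_reals all_analysis.
From mathcomp Require Import ring lra.
Import Order.TTheory GRing.Theory Num.Theory.
Import numFieldNormedType.Exports.
Local Open Scope classical_set_scope.
Local Open Scope ring_scope.
Set Implicit Arguments.
Unset Strict Implicit.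
Unset Printing Implicit Defensive.

(** In the channel coding bound, [d = beta0 - G / (1 + a)] is a root of
      [d (d + G / (1 + a) - 1) = G / (1 + a)^2],
    so it tends to [1 / (1 + a)], and [2 E0 - a ln G] is a continuous function
    of [d] and [d / G].

    In the spectrum replication bound, [eta] is a root of
      [eta (G - (1 + r)^2 eta) = r^2 + 1],
    so [eta = G / (1 + r)^2 + O(1 / G)], whence, uniformly in [0 < r <= 1],
      [Phi r G = G r / (1 + r) - r - r ln G + (2 r + 1) ln (1 + r) + O(1 / G)].
    If [1/4 < c], the supremum defining [Lambda c G] is therefore attained at
    [r = 1] up to [O(1 / G)], and for [c = a / (2 (1 + a))] the terms of the
    bound that are linear in [G] cancel. For all [0 < c], [Lambda c G / G] tends
    to the maximum over [r] of [1 / (1 + r) - c / r]. The resulting slope of the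
    bound is positive once [c] exceeds [a / (2 (1 + a))] and [a / (3 a + 1)].
    When [a < 2] the formula that defines [gamma_bar] on its middle range
    exceeds both, and it is a lower bound of [gamma_bar] on the first range too,
    by the estimate [q (1 - q) <= 1/4] in [psi]. *)

Section RealInequalities.
Context {R : realType}.
Implicit Types a b : R.

Lemma le_sqrtr a b : a ^+ 2 <= b -> a <= Num.sqrt b.
Proof.
by move=> ab; apply: (le_trans (ler_norm a)); rewrite -sqrtr_sqr ler_wsqrtr.
Qed.

Lemma sqrtr_le a b : 0 <= b -> a <= b ^+ 2 -> Num.sqrt a <= b.
Proof.
by move=> b0 ab; rewrite -[leRHS](ger0_norm b0) -sqrtr_sqr ler_wsqrtr.
Qed.

Lemma lnB_le a b : 0 < a -> 0 < b -> ln a - ln b <= (a - b) / b.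
Proof.
move=> a0 b0; rewrite -ln_div ?posrE// -[a / b](subrKC 1).
rewrite mulrBl divff ?gt_eqF//.
by apply: le_ln1Dx; rewrite ltrBrDl subrr divr_gt0.
Qed.

Lemma sup_image_le {T} (A : set T) (f : T -> R) b :
  A !=set0 -> (forall x, A x -> f x <= b) -> sup [set f x | x in A] <= b.
Proof.
move=> A0 fb; apply: ge_sup; first exact: image_nonempty.
by move=> _ [x Ax <-]; exact: fb.
Qed.

Lemma le_sup_image {T} (A : set T) (f : T -> R) b x :
  (forall y, A y -> f y <= b) -> A x -> f x <= sup [set f x | x in A].
Proof.
move=> fb Ax; apply: ub_le_sup; last by exists x.
by exists b => _ [y Ay <-]; exact: fb.
Qed.

End RealInequalities.

Section RealLimits.
Context {R : realType}.
Implicit Types a b c G : R.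

Section AnyFilter.
Context {T : Type} {F : set_system T} {FF : Filter F}.

Lemma cvg_maxr (f g : T -> R) a b :
  f x @[x --> F] --> a -> g x @[x --> F] --> b ->
  Num.max (f x) (g x) @[x --> F] --> Num.max a b.
Proof. exact: continuous2_cvg (@max_continuous _ R (a, b)). Qed.

Lemma cvg_minr (f g : T -> R) a b :
  f x @[x --> F] --> a -> g x @[x --> F] --> b ->
  Num.min (f x) (g x) @[x --> F] --> Num.min a b.
Proof. exact: continuous2_cvg (@min_continuous _ R (a, b)). Qed.

End AnyFilter.

Lemma cvg_invr_pinfty : G^-1 @[G --> +oo] --> (0 : R).
Proof.
apply/gtr0_cvgV0; last exact: cvg_id.
exact: nbhs_pinfty_gt (num_real _).
Qed.

Lemma cvg_dist_le_invr (f : R -> R) a b :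
  (\forall G \near +oo, `|f G - a| <= b / G) -> f G @[G --> +oo] --> a.
Proof.
move=> fa; apply/cvgrPdist_le => e e0.
have /cvgr_le bG : (b / G) @[G --> +oo] --> b * 0.
  exact: cvgMl_tmp cvg_invr_pinfty.
near=> G; rewrite distrC (@le_trans _ _ (b / G))//; first by near: G.
by near: G; apply: bG; rewrite mulr0.
Unshelve. all: by end_near. Qed.

(* [ln G = 2 ln (sqrt G) < 2 sqrt G] *)
Lemma cvg_ln_div_pinfty : (ln G / G) @[G --> +oo] --> (0 : R).
Proof.
apply/cvgr0Pnorm_le => e e0; near=> G.
have G1 : 1 <= G by near: G; exact: nbhs_pinfty_ge (num_real _).
have Ge : (2 / e) ^+ 2 <= G by near: G; exact: nbhs_pinfty_ge (num_real _).
have G0 : 0 < G by lra.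
have s0 : 0 < Num.sqrt G by rewrite sqrtr_gt0.
have es : 2 <= e * Num.sqrt G by rewrite mulrC -ler_pdivrMr//; exact: le_sqrtr.
rewrite ger0_norm; last by rewrite divr_ge0 ?ln_ge0// ltW.
rewrite ler_pdivrMr// -[G]sqr_sqrtr ?ltW// lnXn// -mulr_natl.
by have := ln_sublinear s0; nra.
Unshelve. all: by end_near. Qed.

Lemma cvg_linear_sub_ln a c : 0 < c ->
  (c * G - a * ln G) @[G --> +oo] --> +oo.
Proof.
move=> c0; apply/cvgryPge => b.
have /cvgr_le aln : (a * (ln G / G)) @[G --> +oo] --> a * 0.
  exact: cvgMl_tmp cvg_ln_div_pinfty.
near=> G.
have G0 : 0 < G by near: G; exact: nbhs_pinfty_gt (num_real _).
have bG : b / (c / 2) <= G by near: G; exact: nbhs_pinfty_ge (num_real _).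
have half_c : a * (ln G / G) <= c / 2 by near: G; apply: aln; lra.
have -> : c * G - a * ln G = (c - a * (ln G / G)) * G by field; lra.
by rewrite ler_pdivrMr in bG; [nra|lra].
Unshelve. all: by end_near. Qed.

End RealLimits.

Section ChannelCodingBound.
Context {R : realType}.
Implicit Types a c G : R.

Definition beta0_excess a G : R := beta0 a G - G / (1 + a).

Lemma beta0_excess_quadratic a G : 0 < a -> 0 < G ->
  beta0_excess a G * (beta0 a G - 1) = G / (1 + a) ^+ 2.
Proof.
move=> a0 G0; rewrite /beta0_excess /beta0; set q := Num.sqrt _.
have -> : (2^-1 * (1 + G / (1 + a)) * (1 + q) - G / (1 + a)) *
    (2^-1 * (1 + G / (1 + a)) * (1 + q) - 1) =
  G / (1 + a) - ((1 + a + G) / (1 + a)) ^+ 2 * (1 - q ^+ 2) / 4 by field; lra.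
rewrite sqr_sqrtr; first by field; lra.
rewrite subr_ge0 ler_pdivrMr ?exprn_gt0//; last lra.
by have := sqr_ge0 (1 + a - G); nra.
Qed.

Lemma beta0_bounds a G : 0 < a -> 0 < G ->
  2^-1 * (1 + G / (1 + a)) <= beta0 a G <= 1 + G / (1 + a).
Proof.
move=> a0 G0; rewrite /beta0; set q := Num.sqrt _.
have GV0 : 0 < G / (1 + a) by rewrite divr_gt0//; lra.
have q0 : 0 <= q by exact: sqrtr_ge0.
have q1 : q <= 1.
  apply: sqrtr_le => //; rewrite expr1n gerBl divr_ge0 ?sqr_ge0// ltW//.
  by rewrite !mulr_gt0.
by apply/andP; split; nra.
Qed.

Lemma dist_beta0_excess_le a G : 0 < a -> 1 + a < G ->
  `|beta0_excess a G - (1 + a)^-1| <= (1 + a) / G.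
Proof.
move=> a0 aG; have G0 : 0 < G by lra.
have m0 : 0 < 1 + a by lra.
set x := G / (1 + a).
have x1 : 1 < x by rewrite ltr_pdivlMr; lra.
have /andP[] := beta0_bounds a0 G0.
have := beta0_excess_quadratic a0 G0.
have -> : G / (1 + a) ^+ 2 = x / (1 + a) by rewrite /x; field; lra.
have -> : beta0 a G = beta0_excess a G + x by rewrite /beta0_excess -/x subrK.
set d := beta0_excess a G; rewrite -/x => quad dlo dhi.
have d0 : 0 < d.
  rewrite -(@pmulr_lgt0 _ (d + x - 1)); last lra.
  by rewrite quad divr_gt0//; lra.
have xd : x * (d - (1 + a)^-1) = d * (1 - d) by rewrite mulrBr -quad; ring.
have dist_ge0 : 0 <= d - (1 + a)^-1.
  by rewrite -(@pmulr_rge0 _ x) ?xd; nra.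
rewrite -[(1 + a) / G]invf_div -/x -[leRHS]mul1r ler_pdivlMr; last lra.
by rewrite ger0_norm// mulrC xd; nra.
Qed.

Lemma cvg_beta0_excess a : 0 < a ->
  beta0_excess a G @[G --> +oo] --> (1 + a)^-1.
Proof.
move=> a0; apply: (@cvg_dist_le_invr _ _ _ (1 + a)); near=> G.
apply: dist_beta0_excess_le => //.
by near: G; exact: nbhs_pinfty_gt (num_real _).
Unshelve. all: by end_near. Qed.

Lemma E0_sub_ln a G : 0 < a -> 1 + a < G ->
  2 * E0 a G - a * ln G =
  (1 + a) * (1 - beta0_excess a G) + ln (beta0_excess a G)
  + a * ln (beta0_excess a G / G + (1 + a)^-1).
Proof.
move=> a0 aG; have G0 : 0 < G by lra.
have /andP[beta_ge _] := beta0_bounds a0 G0.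
have GV0 : 0 < G / (1 + a) by rewrite divr_gt0//; lra.
have -> : beta0_excess a G / G + (1 + a)^-1 = beta0 a G / G.
  by rewrite /beta0_excess; field; lra.
rewrite ln_div ?posrE; [|lra|lra].
by rewrite /E0 /beta0_excess; field; lra.
Qed.

Lemma cvg_E0 a : 0 < a ->
  (2 * E0 a G - a * ln G) @[G --> +oo] --> a - (1 + a) * ln (1 + a).
Proof.
move=> a0; have mV0 : 0 < (1 + a)^-1 by rewrite invr_gt0; lra.
have excess := cvg_beta0_excess a0.
have ratio : (beta0_excess a G / G + (1 + a)^-1) @[G --> +oo] --> (1 + a)^-1.
  rewrite -[X in _ --> X]add0r -[X in _ --> X + _](mulr0 (1 + a)^-1).
  by apply: cvgD; [exact: cvgM excess cvg_invr_pinfty|exact: cvg_cst].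
have ln_excess : ln (beta0_excess a G) @[G --> +oo] --> ln (1 + a)^-1.
  exact: (continuous_cvg _ (continuous_ln mV0) excess).
have ln_ratio : ln (beta0_excess a G / G + (1 + a)^-1) @[G --> +oo]
    --> ln (1 + a)^-1.
  exact: (continuous_cvg _ (continuous_ln mV0) ratio).
have -> : a - (1 + a) * ln (1 + a) =
    (1 + a) * (1 - (1 + a)^-1) + ln (1 + a)^-1 + a * ln (1 + a)^-1.
  by rewrite lnV ?posrE; [field; lra|lra].
have : ((1 + a) * (1 - beta0_excess a G) + ln (beta0_excess a G)
        + a * ln (beta0_excess a G / G + (1 + a)^-1)) @[G --> +oo] -->
    (1 + a) * (1 - (1 + a)^-1) + ln (1 + a)^-1 + a * ln (1 + a)^-1.
  apply: cvgD; last exact: cvgMl_tmp ln_ratio.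
  apply: cvgD ln_excess.
  by apply: cvgMl_tmp; apply: cvgB excess; exact: cvg_cst.
apply: cvg_trans; apply: near_eq_cvg; near=> G; rewrite E0_sub_ln//.
by near: G; exact: nbhs_pinfty_gt (num_real _).
Unshelve. all: by end_near. Qed.

Lemma cvg_cc_bound a c : 0 < a -> 0 < c ->
  (cc_bound a c G - a * ln G) @[G --> +oo] --> a - (1 + a) * ln (1 + a).
Proof.
move=> a0 c0; set l := _ - _; have E0l := cvg_E0 a0.
apply: cvg_trans E0l; apply: near_eq_cvg.
have /cvgr_le E0_le := cvg_E0 a0.
have /cvgryPge cG_ge := cvg_linear_sub_ln a c0.
near=> G; rewrite /cc_bound min_l// -(lerD2r (- (a * ln G))).
apply: (@le_trans _ _ (l + 1)); near: G; last exact: cG_ge.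
by apply: E0_le; rewrite ltrDl.
Unshelve. all: by end_near. Qed.

End ChannelCodingBound.

Section SphericalCapBound.
Context {R : realType}.
Implicit Types a c G : R.

Lemma cvg_sc_bound a c : 0 < a -> 0 < c ->
  (sc_bound a c G - a * ln G) @[G --> +oo] --> a * ln (c / a) + a.
Proof.
move=> a0 c0; apply: cvg_near_cst; near=> G.
have G0 : 0 < G by near: G; exact: nbhs_pinfty_gt (num_real _).
have acG : a / c <= G by near: G; exact: nbhs_pinfty_ge (num_real _).
rewrite /sc_bound ltNge acG /= [c * G / a]mulrAC.
by rewrite [in LHS]lnM ?posrE ?divr_gt0//; ring.
Unshelve. all: by end_near. Qed.

End SphericalCapBound.

Section PhiExpansion.
Context {R : realType}.
Local Notation eta := Defs.eta.
Implicit Types r G : R.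

Lemma eta_quadratic r G : 0 < r + 1 ->
  4 * (r ^+ 2 + 1) * (r + 1) ^+ 2 <= G ^+ 2 ->
  eta r G * (G - (r + 1) ^+ 2 * eta r G) = r ^+ 2 + 1.
Proof.
move=> m0 disc; rewrite /eta; set D := Num.sqrt _; set m := r + 1.
have mN0 : m != 0 by rewrite gt_eqF.
have -> : (G + D) / (2 * m ^+ 2) * (G - m ^+ 2 * ((G + D) / (2 * m ^+ 2))) =
  (G ^+ 2 - D ^+ 2) / (4 * m ^+ 2) by field.
by rewrite sqr_sqrtr ?subr_ge0// -/m; field.
Qed.

Lemma eta_ge_half r G : 0 < 1 + r -> G / (2 * (1 + r) ^+ 2) <= eta r G.
Proof.
move=> m0; rewrite /eta [r + 1]addrC ler_pM2r ?lerDl ?sqrtr_ge0//.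
by rewrite invr_gt0 mulr_gt0// exprn_gt0.
Qed.

Lemma eta_ge_eighth r G : 0 < r -> r <= 1 -> 0 <= G -> G / 8 <= eta r G.
Proof.
move=> r0 r1 G0; apply: (@le_trans _ _ (G / (2 * (1 + r) ^+ 2))).
  by rewrite ler_wpM2l// lef_pV2 ?posrE//; nra.
by apply: eta_ge_half; lra.
Qed.

(* The quadratic equation turns the gap into [(r^2 + 1) / ((1 + r)^2 eta)]. *)
Lemma eta_gap_bounds r G : 0 < r -> r <= 1 -> 8 <= G ->
  0 <= G / (1 + r) ^+ 2 - eta r G <= 4 / G.
Proof.
move=> r0 r1 G8; have G0 : 0 < G by lra.
have m0 : 0 < 1 + r by lra.
have m2_gt0 : 0 < (1 + r) ^+ 2 by rewrite exprn_gt0.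
have m2_le4 : (1 + r) ^+ 2 <= 4 by nra.
have r2_le1 : r ^+ 2 <= 1 by nra.
have quad : eta r G * (G - (1 + r) ^+ 2 * eta r G) = r ^+ 2 + 1.
  by rewrite [1 + r]addrC eta_quadratic 1?addrC//; nra.
have m2eta_ge : G / 2 <= (1 + r) ^+ 2 * eta r G.
  by rewrite [leRHS]mulrC -ler_pdivrMr// -mulrA -invfM eta_ge_half.
have m2eta0 : 0 < (1 + r) ^+ 2 * eta r G by lra.
have eta0 : 0 < eta r G by rewrite -(pmulr_rgt0 _ m2_gt0).
have -> : G / (1 + r) ^+ 2 - eta r G =
    (r ^+ 2 + 1) / ((1 + r) ^+ 2 * eta r G).
  by rewrite -quad; field; lra.
apply/andP; split; first by apply: divr_ge0; [nra|exact: ltW].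
by rewrite ler_pdivrMr// mulrAC ler_pdivlMr//; nra.
Qed.

(* The upper bound is AM-GM: [4 eta G] is four times the product of
   [(1 + r) eta] and [G / (1 + r)]. *)
Lemma sqrt_eta_bounds r G : 0 < r -> r <= 1 -> 8 <= G ->
  2 * ((1 + r) * eta r G) <= Num.sqrt (4 * eta r G * G + 1)
    <= (1 + r) * eta r G + G / (1 + r) + G^-1.
Proof.
move=> r0 r1 G8; have G0 : 0 < G by lra.
have eta_ge := eta_ge_eighth r0 r1 (ltW G0).
have /andP[gap_ge _] := eta_gap_bounds r0 r1 G8.
have m0 : 0 < 1 + r by lra.
have GV0 : 0 < G^-1 by rewrite invr_gt0.
have -> : 4 * eta r G * G + 1 =
  4 * ((1 + r) * eta r G) * (G / (1 + r)) + 1 by field; lra.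
have x_le_y : (1 + r) * eta r G <= G / (1 + r).
  rewrite ler_pdivlMr//; rewrite subr_ge0 ler_pdivlMr ?exprn_gt0// in gap_ge.
  by lra.
have x0 : 0 < (1 + r) * eta r G by rewrite mulr_gt0//; lra.
have y_large : 2^-1 <= G / (1 + r) * G^-1.
  by rewrite mulrAC divff ?mul1r ?lef_pV2 ?posrE; lra.
move: ((1 + r) * _) (G / _) x0 x_le_y y_large => x y x0 x_le_y y_large.
apply/andP; split; first by apply: le_sqrtr; nra.
apply: sqrtr_le; first by lra.
by have := sqr_ge0 (x - y); have : 0 < x * G^-1 by [rewrite mulr_gt0]; nra.
Qed.

Lemma ln_eta_bounds r G : 0 < r -> r <= 1 -> 8 <= G ->
  ln G - 2 * ln (1 + r) - 4 / G <= ln (eta r G)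
    <= ln G - 2 * ln (1 + r).
Proof.
move=> r0 r1 G8; have G0 : 0 < G by lra.
have eta_ge := eta_ge_eighth r0 r1 (ltW G0).
have /andP[gap_ge gap_le] := eta_gap_bounds r0 r1 G8.
have m0 : 0 < 1 + r by lra.
have eta0 : 0 < eta r G by lra.
have x0 : 0 < G / (1 + r) ^+ 2 by lra.
have GV0 : 0 < 4 / G by rewrite divr_gt0.
have -> : ln G - 2 * ln (1 + r) = ln (G / (1 + r) ^+ 2).
  by rewrite ln_div ?posrE ?exprn_gt0// lnXn// mulr_natl.
rewrite ler_ln ?posrE// -[_ <= G / _]subr_ge0 gap_ge andbT.
have : (G / (1 + r) ^+ 2 - eta r G) / eta r G <= 4 / G.
  by rewrite ler_pdivrMr//; nra.
by have := lnB_le x0 eta0; lra.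
Qed.

Lemma ln_sqrt_eta_ratio_bounds r G : 0 < r -> r <= 1 -> 8 <= G ->
  ln (1 + r) <=
    ln ((Num.sqrt (4 * eta r G * G + 1) + 1) / (2 * eta r G))
    <= ln (1 + r) + 12 / G.
Proof.
move=> r0 r1 G8; have G0 : 0 < G by lra.
have m0 : 0 < 1 + r by lra.
have eta_ge := eta_ge_eighth r0 r1 (ltW G0).
have /andP[gap_ge gap_le] := eta_gap_bounds r0 r1 G8.
have /andP[] := sqrt_eta_bounds r0 r1 G8.
set e := eta r G in eta_ge gap_ge gap_le *.
set S := Num.sqrt _ => S_ge S_le.
have e0 : 0 < e by lra.
have GV_le : G^-1 <= 8^-1 by rewrite lef_pV2 ?posrE//; lra.
have GV0 : 0 < 12 / G by rewrite divr_gt0.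
have ratio_ge : 1 + r <= (S + 1) / (2 * e) by rewrite ler_pdivlMr; lra.
have ratio0 : 0 < (S + 1) / (2 * e) by lra.
rewrite ler_ln ?posrE// ratio_ge /=.
have S_near : S <= 2 * ((1 + r) * e) + 2.
  have : (1 + r) * (G / (1 + r) ^+ 2 - e) <= 2 * (4 / G) by nra.
  have -> : (1 + r) * (G / (1 + r) ^+ 2 - e) = G / (1 + r) - (1 + r) * e.
    by field; lra.
  by lra.
have ratio_le : (S + 1) / (2 * e) - (1 + r) <= 12 / G.
  have : 3 <= 12 / G * (2 * e) by rewrite mulrAC ler_pdivlMr; lra.
  by rewrite lerBlDr ler_pdivrMr; lra.
have : ((S + 1) / (2 * e) - (1 + r)) / (1 + r) <= 12 / G.
  by rewrite ler_pdivrMr//; nra.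
by have := lnB_le ratio0 m0; lra.
Qed.

Definition Phi_expansion r G : R :=
  G - G / (1 + r) - r - r * ln G + (2 * r + 1) * ln (1 + r).

Lemma dist_Phi_expansion_le r G : 0 < r -> r <= 1 -> 8 <= G ->
  `|Phi r G - Phi_expansion r G| <= 24 / G.
Proof.
move=> r0 r1 G8; rewrite /Phi /Phi_expansion.
have /andP[gap_ge gap_le] := eta_gap_bounds r0 r1 G8.
have /andP[] := sqrt_eta_bounds r0 r1 G8.
have /andP[] := ln_eta_bounds r0 r1 G8.
have /andP[] := ln_sqrt_eta_ratio_bounds r0 r1 G8.
set e := eta r G in gap_ge gap_le *; set S := Num.sqrt _.
move=> ratio_ge ratio_le ln_eta_ge ln_eta_le S_ge S_le.
have GV0 : 0 < G^-1 by rewrite invr_gt0; lra.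
have m_gap : 0 <= G / (1 + r) - (1 + r) * e <= 8 / G.
  have -> : G / (1 + r) - (1 + r) * e = (1 + r) * (G / (1 + r) ^+ 2 - e).
    by field; lra.
  by apply/andP; split; nra.
have r_ln_eta : r * (ln G - 2 * ln (1 + r)) - 4 / G <= r * ln e
                <= r * (ln G - 2 * ln (1 + r)).
  by rewrite ler_pM2l// ln_eta_le andbT; nra.
rewrite ler_norml; move: (ln e) (ln (1 + r)) (ln G) (G / (1 + r)) (ln (_ / _))
  ratio_ge ratio_le S_ge S_le m_gap r_ln_eta => *.
by apply/andP; split; lra.
Qed.

End PhiExpansion.

Section LambdaSupremum.
Context {R : realType}.
Implicit Types a b c r G : R.

Definition Lambda_objective c G r : R := (Phi r G - c * G) / r.

Lemma Lambda_le c G b :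
  (forall r, 0 < r -> r <= 1 -> Lambda_objective c G r <= b) -> Lambda c G <= b.
Proof.
move=> obj_le; apply: sup_image_le.
  by exists 1; rewrite /= in_itv/= ltr01 lexx.
by move=> r; rewrite /= in_itv/= => /andP[r0 r1]; exact: obj_le.
Qed.

Lemma le_Lambda c G b r :
  (forall t, 0 < t -> t <= 1 -> Lambda_objective c G t <= b) ->
  0 < r -> r <= 1 -> Lambda_objective c G r <= Lambda c G.
Proof.
move=> obj_le r0 r1; apply: (@le_sup_image _ _ _ (Lambda_objective c G) b).
  by move=> t; rewrite /= in_itv/= => /andP[t0 t1]; exact: obj_le.
by rewrite /= in_itv/= r0.
Qed.

End LambdaSupremum.

Section SpectrumReplicationBound.
Context {R : realType}.
Implicit Types a c r G : R.

(* Beyond [c = 1/4] the terms of [Lambda_objective] linear in [G] increase up to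
   [r = 1]. *)
Lemma Lambda_objective_le_endpoint c G r :
  0 < r -> r <= 1 -> 8 <= G -> 4 <= (c - 4^-1) * G ->
  Lambda_objective c G r <=
    (2^-1 - c) * G - ln G + (3 * ln 2 - 1) + 24 / G.
Proof.
move=> r0 r1 G8 c_large; have G0 : 0 < G by lra.
have := dist_Phi_expansion_le r0 r1 G8; rewrite ler_distl => /andP[_].
rewrite /Lambda_objective /Phi_expansion ler_pdivrMr//.
have ln_le : ln (1 + r) <= ln 2 by rewrite ler_ln ?posrE; lra.
have ln2_le1 : ln 2 <= 1 :> R by have := @le_ln1Dx R 1; lra.
have ln_terms : (2 * r + 1) * ln (1 + r) <= 3 * r * ln 2 + (1 - r).
  by have : (2 * r + 1) * ln (1 + r) <= (2 * r + 1) * ln 2; nra.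
have frac_le : G - G / (1 + r) <= G * (r / 2 + (1 - r) / 4).
  have -> : G - G / (1 + r) = G * (r / (1 + r)) by field; lra.
  by rewrite ler_pM2l// ler_pdivrMr; nra.
have c_gap : 4 * (1 - r) <= (c - 4^-1) * G * (1 - r).
  by rewrite ler_wpM2r//; lra.
have err_gap : 24 / G * (1 - r) <= 3 * (1 - r).
  by rewrite ler_wpM2r ?ler_pdivrMr//; lra.
move: (G / (1 + r)) (ln (1 + r)) (ln 2) (ln G) (Phi r G) ln_terms frac_le => *.
lra.
Qed.

Lemma dist_Lambda_le c G : 8 <= G -> 4 <= (c - 4^-1) * G ->
  `|Lambda c G - ((2^-1 - c) * G - ln G + (3 * ln 2 - 1))| <= 24 / G.
Proof.
move=> G8 c_large; rewrite ler_distl; apply/andP; split; last first.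
  by apply: Lambda_le => r r0 r1; exact: Lambda_objective_le_endpoint.
apply: (@le_trans _ _ (Lambda_objective c G 1)); last first.
  by apply: le_Lambda => // r r0 r1; exact: Lambda_objective_le_endpoint.
have := dist_Phi_expansion_le ltr01 (lexx 1) G8.
rewrite ler_distl => /andP[+ _].
rewrite /Lambda_objective /Phi_expansion divr1 (_ : 1 + 1 = 2 :> R)//.
by move: (ln G) (ln 2) (Phi 1 G) => *; lra.
Qed.

Lemma near_dist_Lambda_le c : 4^-1 < c -> \forall G \near +oo,
  `|Lambda c G - ((2^-1 - c) * G - ln G + (3 * ln 2 - 1))| <= 24 / G.
Proof.
move=> c_gt; near=> G; apply: dist_Lambda_le.
  by near: G; exact: nbhs_pinfty_ge (num_real _).
rewrite mulrC -ler_pdivrMr; last by rewrite subr_gt0.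
by near: G; exact: nbhs_pinfty_ge (num_real _).
Unshelve. all: by end_near. Qed.

Lemma near_Lambda_ge0 c : 4^-1 < c -> c < 2^-1 ->
  \forall G \near +oo, 0 <= Lambda c G.
Proof.
move=> c_gt c_lt; have c_gap : 0 < 2^-1 - c by lra.
have /cvgryPge linear_ge := cvg_linear_sub_ln 1 c_gap.
near=> G.
have G8 : 8 <= G by near: G; exact: nbhs_pinfty_ge (num_real _).
have linear_ge4 : 4 <= (2^-1 - c) * G - 1 * ln G by near: G; exact: linear_ge.
have : `|Lambda c G - ((2^-1 - c) * G - ln G + (3 * ln 2 - 1))| <= 24 / G.
  by near: G; exact: near_dist_Lambda_le.
rewrite ler_distl => /andP[+ _].
have : 0 <= ln 2 :> R by apply: ln_ge0; lra.
have : 24 / G <= 3 by rewrite ler_pdivrMr; lra.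
lra.
Unshelve. all: by end_near. Qed.

Lemma cvg_sr_bound a : 1 < a ->
  (sr_bound a (a / (2 * (1 + a))) G - a * ln G) @[G --> +oo]
    --> a * ln (expR 1 / 8).
Proof.
move=> a1; set c := a / _.
have c_eq : c = a * (2^-1 - c) by rewrite /c; field; lra.
have c_gt : 4^-1 < c by rewrite /c ltr_pdivlMr; lra.
have c_lt : c < 2^-1 by rewrite /c ltr_pdivrMr; lra.
have -> : ln (expR 1 / 8) = 1 - 3 * ln 2 :> R.
  rewrite ln_div ?posrE ?expR_gt0// expRK (_ : 8 = 2 ^+ 3); last by ring.
  by rewrite lnXn ?mulr_natl.
apply: (@cvg_dist_le_invr _ _ _ (a * 24)); near=> G.
have Lambda0 : 0 <= Lambda c G by near: G; exact: near_Lambda_ge0.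
rewrite /sr_bound max_l; last by apply: mulr_ge0 => //; lra.
rewrite {1}c_eq (_ : _ - _ - _ =
  a * ((2^-1 - c) * G - ln G + (3 * ln 2 - 1) - Lambda c G)); last by ring.
rewrite normrM gtr0_norm; last lra.
rewrite distrC -mulrA ler_pM2l; last lra.
by near: G; exact: near_dist_Lambda_le.
Unshelve. all: by end_near. Qed.

End SpectrumReplicationBound.

Section SpectrumReplicationSlope.
Context {R : realType}.
Implicit Types a c d r G : R.

(* The limit of [Lambda_objective c G r / G] at fixed [r]. *)
Definition objective_slope c r : R := (1 + r)^-1 - c / r.

(* The maximum of [objective_slope c r] over [0 < r <= 1]: it is
   [(1 - t) (1 - c / t)] with [t = r / (1 + r)], where [0 < t <= 1/2], and
   increases with [t] up to [sqrt c], then decreases. *)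
Definition Lambda_slope c : R :=
  let s := Num.min (Num.sqrt c) 2^-1 in (1 - s) * (1 - c / s).

Lemma objective_slope_le c r : 0 < c -> 0 < r -> r <= 1 ->
  objective_slope c r <= Lambda_slope c.
Proof.
move=> c0 r0 r1; rewrite /Lambda_slope /=.
have sqrt_c0 : 0 < Num.sqrt c by rewrite sqrtr_gt0.
have sqr_c : Num.sqrt c ^+ 2 = c by rewrite sqr_sqrtr// ltW.
set t := r / (1 + r).
have t0 : 0 < t by rewrite divr_gt0//; lra.
have t_le : t <= 2^-1 by rewrite ler_pdivrMr; lra.
have -> : objective_slope c r = (1 - t) * (1 - c / t).
  by rewrite /objective_slope /t; field; lra.
case: (leP (Num.sqrt c)) => [s_le|s_gt]; rewrite -subr_ge0.
  move: sqr_c sqrt_c0; set s := Num.sqrt c => <- s0.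
  have -> : (1 - s) * (1 - s ^+ 2 / s) - (1 - t) * (1 - s ^+ 2 / t) =
    (t - s) ^+ 2 / t by field; lra.
  by rewrite divr_ge0 ?sqr_ge0// ltW.
have -> : (1 - 2^-1) * (1 - c / 2^-1) - (1 - t) * (1 - c / t) =
  (2^-1 - t) * (2 * c - t) / t by field; lra.
have c_gt : 4^-1 < c by nra.
by apply: divr_ge0; [apply: mulr_ge0; lra|exact: ltW].
Qed.

Lemma Lambda_slope_attained c : 0 < c ->
  exists r, [/\ 0 < r, r <= 1 & objective_slope c r = Lambda_slope c].
Proof.
move=> c0; rewrite /Lambda_slope /=; set s := Num.min _ _.
have s0 : 0 < s by rewrite lt_min sqrtr_gt0 c0 invr_gt0 ltr0n.
have s_le : s <= 2^-1 by rewrite ge_min lexx orbT.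
exists (s / (1 - s)); split; first by rewrite divr_gt0//; lra.
  by rewrite ler_pdivrMr; lra.
by rewrite /objective_slope; field; lra.
Qed.

Lemma continuous_Lambda_slope c : 0 < c -> {for c, continuous Lambda_slope}.
Proof.
move=> c0; rewrite /prop_for /continuous_at /Lambda_slope.
set s := fun x : R => Num.min (Num.sqrt x) 2^-1.
have s_cvg : s x @[x --> c] --> s c.
  by apply: cvg_minr (cvg_cst _); exact: sqrt_continuous.
have sN0 : s c != 0.
  by rewrite gt_eqF// lt_min sqrtr_gt0 c0 invr_gt0 ltr0n.
apply: cvgM; apply: cvgB; [exact: cvg_cst|exact: s_cvg|exact: cvg_cst|].
by apply: cvgM; [exact: cvg_id|exact: cvgV].
Qed.

Lemma Lambda_objective_bounds c G r : 0 < r -> r <= 1 -> 8 <= G ->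
  objective_slope (c + 24 / G ^+ 2) r * G - (1 + ln G) <= Lambda_objective c G r
    <= objective_slope (c - 24 / G ^+ 2) r * G + 3.
Proof.
move=> r0 r1 G8; have G0 : 0 < G by lra.
have := dist_Phi_expansion_le r0 r1 G8; rewrite ler_distl /Phi_expansion.
have slopeE d : objective_slope (c + d) r * G * r =
    G - G / (1 + r) - c * G - d * G.
  by rewrite /objective_slope; field; lra.
have errE : 24 / G ^+ 2 * G = 24 / G by field; lra.
rewrite /Lambda_objective ler_pdivlMr// ler_pdivrMr//.
rewrite mulrBl [(_ + 3) * r]mulrDl !slopeE mulNr errE.
have lnG0 : 0 <= r * ln G by rewrite mulr_ge0 ?ln_ge0 ?ltW//; lra.
have ln0 : 0 <= (2 * r + 1) * ln (1 + r).
  by rewrite mulr_ge0 ?ln_ge0//; lra.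
have ln_le : (2 * r + 1) * ln (1 + r) <= 3 * r.
  have : ln (1 + r) <= r by apply: le_ln1Dx; lra.
  by nra.
move: (ln G) (G / (1 + r)) (Phi r G) ((2 * r + 1) * ln (1 + r)) lnG0 ln0 ln_le.
by move=> ? ? ? ? ? ? ? /andP[? ?]; apply/andP; split; lra.
Qed.

(* The error [24 / G] in [Phi] is not proportional to [r], but it is equivalent
   to a shift of [c], under which [Lambda_slope] is continuous. *)
Lemma Lambda_bounds c G : 8 <= G -> 24 / G ^+ 2 < c ->
  Lambda_slope (c + 24 / G ^+ 2) * G - (1 + ln G) <= Lambda c G
    <= Lambda_slope (c - 24 / G ^+ 2) * G + 3.
Proof.
move=> G8; set d := 24 / _ => d_lt; have G0 : 0 < G by lra.
have d0 : 0 < d by rewrite divr_gt0 ?exprn_gt0.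
have obj_le r : 0 < r -> r <= 1 ->
    Lambda_objective c G r <= Lambda_slope (c - d) * G + 3.
  move=> r0 r1; have /andP[_] := Lambda_objective_bounds c r0 r1 G8.
  move=> /le_trans; apply; rewrite lerD2r ler_pM2r//.
  by rewrite objective_slope_le// subr_gt0.
rewrite Lambda_le// andbT.
have [|r [r0 r1 <-]] := @Lambda_slope_attained (c + d); first lra.
have /andP[obj_ge _] := Lambda_objective_bounds c r0 r1 G8.
by apply: le_trans obj_ge _; exact: le_Lambda obj_le r0 r1.
Qed.

Lemma cvg_Lambda_div c : 0 < c ->
  (Lambda c G / G) @[G --> +oo] --> Lambda_slope c.
Proof.
move=> c0.
have err_cvg : (24 / G ^+ 2) @[G --> +oo] --> (0 : R).
  rewrite -[X in _ --> X](mulr0 24); apply: cvgMl_tmp.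
  rewrite -[X in _ --> X](mulr0 0).
  under eq_fun do rewrite expr2 invfM.
  by apply: cvgM; exact: cvg_invr_pinfty.
have Lambda_slope_shift (d : R -> R) : d G @[G --> +oo] --> c ->
    Lambda_slope (d G) @[G --> +oo] --> Lambda_slope c.
  by move=> dc; exact: continuous_cvg _ (continuous_Lambda_slope c0) dc.
have lower : (Lambda_slope (c + 24 / G ^+ 2) - (G^-1 + ln G / G)) @[G --> +oo]
    --> Lambda_slope c.
  rewrite -[X in _ --> X]subr0 -[X in _ --> _ - X](addr0 0).
  apply: cvgB; last exact: cvgD cvg_invr_pinfty cvg_ln_div_pinfty.
  apply: Lambda_slope_shift; rewrite -[X in _ --> X]addr0.
  by apply: cvgD err_cvg; exact: cvg_cst.
have upper : (Lambda_slope (c - 24 / G ^+ 2) + 3 / G) @[G --> +oo]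
    --> Lambda_slope c.
  rewrite -[X in _ --> X]addr0 -[X in _ --> _ + X](mulr0 3).
  apply: cvgD; last exact: cvgMl_tmp cvg_invr_pinfty.
  apply: Lambda_slope_shift; rewrite -[X in _ --> X]subr0.
  by apply: cvgB err_cvg; exact: cvg_cst.
apply: squeeze_cvgr lower upper; near=> G.
have G8 : 8 <= G by near: G; exact: nbhs_pinfty_ge (num_real _).
have err_lt : 24 / G ^+ 2 < c by near: G; exact: cvgr_lt err_cvg _ c0.
have /andP[lo hi] := Lambda_bounds G8 err_lt.
rewrite ler_pdivlMr ?ler_pdivrMr; [|lra|lra].
rewrite mulrBl ![(_ + _ / G) * G]mulrDl mulVf ?divfK ?lo ?hi; lra.
Unshelve. all: by end_near. Qed.

Lemma cvg_sr_bound_div a c : 0 < c ->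
  (sr_bound a c G / G) @[G --> +oo] --> c - Num.max (a * Lambda_slope c) 0.
Proof.
move=> c0.
have : (c - Num.max (a * (Lambda c G / G)) 0) @[G --> +oo]
    --> c - Num.max (a * Lambda_slope c) 0.
  apply: cvgB; first exact: cvg_cst.
  by apply: cvg_maxr (cvg_cst _); exact: cvgMl_tmp (cvg_Lambda_div c0).
apply: cvg_trans; apply: near_eq_cvg; near=> G.
have G0 : 0 < G by near: G; exact: nbhs_pinfty_gt (num_real _).
rewrite /sr_bound mulrBl mulfK ?gt_eqF// mulrA maxr_pMl ?mul0r//.
by rewrite invr_ge0 ltW.
Unshelve. all: by end_near. Qed.

(* Sharp for [1 <= a]; for [a < 1] the sharp one is [a / (1 + sqrt a)^2]. *)
Definition slope_threshold a : R :=
  Num.max (a / (2 * (1 + a))) (a / (3 * a + 1)).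

Lemma slope_threshold_gt0 a : 0 < a -> 0 < slope_threshold a.
Proof. by move=> a0; rewrite lt_max divr_gt0//; lra. Qed.

Lemma Lambda_slope_lt a c : 0 < a -> slope_threshold a < c ->
  a * Lambda_slope c < c.
Proof.
move=> a0 ac; have c0 := lt_trans (slope_threshold_gt0 a0) ac.
move: ac; rewrite gt_max !ltr_pdivrMr ?mulr_gt0; [|lra..].
rewrite /Lambda_slope /=.
case: (leP (Num.sqrt c)) => [s_le|_] /andP[]; last by lra.
have sqr_c : Num.sqrt c ^+ 2 = c by rewrite sqr_sqrtr// ltW.
have s0 : 0 < Num.sqrt c by rewrite sqrtr_gt0.
move: s_le sqr_c s0; set s := Num.sqrt c => s_le <- s0 _ c_gt.
have -> : (1 - s) * (1 - s ^+ 2 / s) = (1 - s) ^+ 2 by field; lra.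
have : (1 - s) ^+ 2 <= 1 - 3 * s ^+ 2 by nra.
by nra.
Qed.

End SpectrumReplicationSlope.

Section GammaBar.
Context {R : realType}.
Implicit Types a : R.

Definition gamma_bar_mid a : R :=
  a / (2 * (1 + a)) * (1 + (a + 5 - 4 * Num.sqrt (a + 1)) / (3 * a + 1)).

(* [q (1 - q) <= 1/4] bounds the objective by a quadratic in [q]. *)
Lemma psi_ge a : 0 < a ->
  1 + a - (a + Num.sqrt (a + 1)) ^+ 2 / (3 * a + 1) <= psi a.
Proof.
move=> a0; rewrite /psi lerD2l lerN2; have := sqrtr_ge0 (a + 1).
have : Num.sqrt (a + 1) ^+ 2 = a + 1 by rewrite sqr_sqrtr; lra.
set s := Num.sqrt (a + 1) => ss s0.
apply: sup_image_le => [|q].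
  by exists 1; rewrite /= in_itv/= invf_le1; lra.
rewrite /= in_itv/= => /andP[q_ge q_le].
have sqrt_le : Num.sqrt ((1 - q) * q * (1 + a)) <= s / 2.
  apply: sqrtr_le; first lra.
  rewrite expr_div_n ss; have : (1 - q) * q <= 1 / 4 by nra.
  nra.
have k0 : 0 < 3 * a + 1 by lra.
rewrite ler_pdivlMr//; move: (Num.sqrt _) sqrt_le => t t_le.
have : q * (3 * a + 1) * t <= q * (3 * a + 1) * (s / 2).
  by rewrite ler_wpM2l// mulr_ge0//; lra.
by have := sqr_ge0 (q * (3 * a + 1) - (a + s)); lra.
Qed.

Lemma gamma_bar_mid_le a0 a : 0 < a -> a <= 2 ->
  gamma_bar_mid a <= gamma_bar a0 a.
Proof.
move=> a_gt0 a_le2.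
have sqr_s : Num.sqrt (a + 1) ^+ 2 = a + 1 by rewrite sqr_sqrtr; lra.
rewrite /gamma_bar a_le2 -/(gamma_bar_mid a).
case: ifP => // _; rewrite mulrC ler_pdivlMr; last lra.
have midE : gamma_bar_mid a * (1 + a) =
    1 + a - (a + Num.sqrt (a + 1)) ^+ 2 / (3 * a + 1).
  by rewrite /gamma_bar_mid sqrrD sqr_s; field; lra.
rewrite le_min {2}midE psi_ge// andbT midE.
have s1 : 1 <= Num.sqrt (a + 1) by apply: le_sqrtr; lra.
have : 1 * (3 * a + 1) <= (a + Num.sqrt (a + 1)) ^+ 2.
  by rewrite sqrrD sqr_s; nra.
by rewrite -ler_pdivlMr; lra.
Qed.

(* [gamma_bar_mid a] is [a / (2 (1 + a)) (1 + (s - 2)^2 / (3 a + 1))] and also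
   [a / (3 a + 1) (1 + (s - 1)^2 / (1 + a))], where [s^2 = a + 1]. *)
Lemma slope_threshold_lt_gamma_bar_mid a :
  0 < a -> a != 3 -> slope_threshold a < gamma_bar_mid a.
Proof.
move=> a0 aN3.
have : Num.sqrt (a + 1) ^+ 2 = a + 1 by rewrite sqr_sqrtr; lra.
have : 1 < Num.sqrt (a + 1) by rewrite -[ltLHS]sqrtr1 ltr_sqrt; lra.
rewrite /slope_threshold /gamma_bar_mid gt_max; set s := Num.sqrt _ => s1 ss.
apply/andP; split.
  have -> : a + 5 - 4 * s = (s - 2) ^+ 2 by rewrite sqrrB ss; ring.
  have s2 : 0 < (s - 2) ^+ 2.
    rewrite lt_def sqr_ge0 andbT sqrf_eq0 subr_eq0.
    by apply: contra_neq aN3 => s_eq2; rewrite s_eq2 in ss; lra.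
  by rewrite ltr_pMr ?ltrDl ?divr_gt0//; lra.
have -> : a / (2 * (1 + a)) * (1 + (a + 5 - 4 * s) / (3 * a + 1)) =
    a / (3 * a + 1) * (1 + (s - 1) ^+ 2 / (1 + a)).
  by rewrite sqrrB ss; field; lra.
by rewrite ltr_pMr ?ltrDl ?divr_gt0 ?exprn_gt0//; lra.
Qed.

End GammaBar.

Unset Implicit Arguments.

Theorem mainTheorem5 (R : realType) (alpha gam : R) :
  0 < alpha -> 0 < gam ->
  (2 <= alpha -> gam = alpha / (2 * (1 + alpha))) ->
  [/\ (cc_bound alpha gam G - alpha * ln G) @[G --> +oo]
        --> alpha - (1 + alpha) * ln (1 + alpha),
      (sc_bound alpha gam G - alpha * ln G) @[G --> +oo]
        --> alpha * ln (gam / alpha) + alpha,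
      (2 <= alpha ->
        (sr_bound alpha gam G - alpha * ln G) @[G --> +oo]
          --> alpha * ln (expR 1 / 8))
    & (alpha < 2 -> forall a0 : R, 0 < a0 -> alpha0_eq a0 = 0 ->
        exists2 c : R, 0 < c &
          (sr_bound alpha (gamma_bar a0 alpha) G / G) @[G --> +oo] --> c)].
Proof.
move=> alpha0 gam0 gamE; split.
- exact: cvg_cc_bound.
- exact: cvg_sc_bound.
- by move=> alpha2; rewrite (gamE alpha2); apply: cvg_sr_bound; lra.
move=> alpha2 a0 _ _; set g := gamma_bar a0 alpha.
have g_gt : slope_threshold alpha < g.
  apply: (@lt_le_trans _ _ (gamma_bar_mid alpha)).
    by apply: slope_threshold_lt_gamma_bar_mid; lra.
  by rewrite gamma_bar_mid_le// ltW.
have g0 : 0 < g := lt_trans (slope_threshold_gt0 alpha0) g_gt.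
exists (g - Num.max (alpha * Lambda_slope g) 0); last exact: cvg_sr_bound_div.
by rewrite subr_gt0 gt_max g0 Lambda_slope_lt.
Qed.
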